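(* Fix $k$ and the constraint data $A^1,b^1,A^2,b^2$. Suppose that for every matrix $C\in\mathbb{R}^{k\times n}$, the Lagrangian dual is strong at every supported efficient solution of the multiobjective integer program $\max\{Cx\mid A^1x\leqq b^1,\ x\in Q\}$. Then $$\mathrm{conv}\left(Q\cap\{x\in\mathbb{R}^n\mid A^1x\leqq b^1\}\right)=\mathrm{conv}(Q)\cap\{x\in\mathbb{R}^n\mid A^1x\leqq b^1\}.$$
   Context: Vector orders on $\mathbb{R}^k$: $x\leqq y$ if $y-x$ has all nonnegative components; $x\le y$ if $x\leqq y$ and $x\ne y$. $\mathbb{R}^k_{>}$: vectors with all positive components; $\mathbb{Z}^n_{\geqq},\mathbb{R}^{k\times m_1}_{\geqq}$: nonnegative entries. Data: $A\in\mathbb{R}^{m\times n}$, $b\in\mathbb{R}^m$, with rows split into $(A^1,b^1)$, $A^1\in\mathbb{R}^{m_1\times n}$, and $(A^2,b^2)$, $A^2\in\mathbb{R}^{(m-m_1)\times n}$; $Q=\{x\in\mathbb{Z}^n_{\geqq}\mid A^2x\leqq b^2\}$. The multiobjective integer program (MOIP) with cost matrix $C$ is $\max\{Cx\mid Ax\leqq b,\ x\in\mathbb{Z}^n_{\geqq}\}=\max\{Cx\mid A^1x\leqq b^1,\ x\in Q\}$. A feasible $x^*$ is efficient if no feasible $x$ satisfies $Cx^*\le Cx$; an efficient $x^*$ is supported if there is $\mu\in\mathbb{R}^k_{>}$ such that $x^*$ maximizes $\mu^\top Cx$ over the feasible region. $\mathrm{Max}(S)$: for $S\subseteq\mathbb{R}^k$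 nonempty and bounded above, the set of $s\in S$ with no $t\in S$ such that $s\le t$; $\mathrm{Max}(S)=M_\infty$ if $S$ is nonempty and not bounded above; $\mathrm{Max}(\emptyset)=-M_\infty$ ($\pm M_\infty$ are formal symbols). $\mathrm{Min}(S)$ is defined analogously with inequalities reversed and the roles of $\pm M_\infty$ exchanged. For $\Lambda\in\mathbb{R}^{k\times m_1}_{\geqq}$, $\mathcal{Y}_{\mathrm{LR}(\Lambda)}=\{Cx+\Lambda(b^1-A^1x)\mid x\in Q\}$. $\mathcal{Y}_{\mathrm{LD}}=\bigcup_{\Lambda\in\mathbb{R}^{k\times m_1}_{\geqq}}\mathrm{Max}(\mathcal{Y}_{\mathrm{LR}(\Lambda)})\subseteq\mathbb{R}^k$, i.e. the set of all points of $\mathbb{R}^k$ that are elements of $\mathrm{Max}(\mathcal{Y}_{\mathrm{LR}(\Lambda)})$ for some $\Lambda$. The Lagrangian dual of the MOIP is $\mathrm{Min}(\mathcal{Y}_{\mathrm{LD}})$. The dual is strong at a solution $x$ if there is $y\in\mathrm{Min}(\mathcal{Y}_{\mathrm{LD}})$ with $y=Cx$.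
   Formalization: The formal theorem assumes that the multiobjective integer program has at least one feasible point and that k ≥ 2; without feasibility, or for k = 0 or k = 1 with real data, the claim as stated is false. *)

(* Defs.v *)
From HB Require Import structures.
From mathcomp Require Import all_boot all_order all_algebra.
From mathcomp Require Import all_classical all_reals.

Set Implicit Arguments.
Unset Strict Implicit.
Unset Printing Implicit Defensive.

Import Order.TTheory GRing.Theory Num.Theory.
Local Open Scope classical_set_scope.
Local Open Scope ring_scope.

Reserved Notation "A <=v B" (at level 70, no associativity).
Reserved Notation "A <v B" (at level 70, no associativity).

Section VectorOrders.
Variables (R : realType) (p q : nat).

Definition mx_leqq (A B : 'M[R]_(p, q)) : Prop := forall i j, A i j <= B i j.

Definition mx_le (A B : 'M[R]_(p, q)) : Prop := mx_leqq A B /\ A <> B.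

End VectorOrders.

Notation "A <=v B" := (mx_leqq A B) : ring_scope.
(* The strict relation is weak dominance (inequality in every component and
   [A <> B]), not strict inequality in every component. *)
Notation "A <v B" := (mx_le A B) : ring_scope.

Section MaxMin.
Variables (R : realType) (k : nat).
Implicit Types S : set 'cV[R]_k.

(* Values of [Max] and [Min]: a set of points, or one of the formal symbols
   [M_infty] (PInfty) and [- M_infty] (NInfty). *)
Inductive vopt : Type :=
  | Points of set 'cV[R]_k
  | PInfty
  | NInfty.

Definition points_of (v : vopt) : set 'cV[R]_k :=
  if v is Points T then T else set0.

Definition bounded_above S : Prop := exists u, forall s, S s -> s <=v u.
Definition bounded_below S : Prop := exists l, forall s, S s -> l <=v s.

Definition Max S : vopt :=
  if `[< S = set0 >] then NInfty
  else if `[< bounded_above S >] then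
    Points [set s : 'cV[R]_k | S s /\ ~ exists2 t, S t & s <v t]
  else PInfty.

Definition Min S : vopt :=
  if `[< S = set0 >] then PInfty
  else if `[< bounded_below S >] then
    Points [set s : 'cV[R]_k | S s /\ ~ exists2 t, S t & t <v s]
  else NInfty.

End MaxMin.

Arguments PInfty {R k}.
Arguments NInfty {R k}.

Definition conv_hull (R : realType) (n : nat) (S : set 'cV[R]_n) :
    set 'cV[R]_n :=
  [set x : 'cV[R]_n | exists (N : nat) (a : 'I_N -> R) (z : 'I_N -> 'cV[R]_n),
     [/\ forall i, 0 <= a i, \sum_(i < N) a i = 1,
         forall i, S (z i) & x = \sum_(i < N) a i *: z i]].

Section MOIP.
Variables (R : realType) (k n m1 m2 : nat).
Variables (A1 : 'M[R]_(m1, n)) (b1 : 'cV[R]_m1).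
Variables (A2 : 'M[R]_(m2, n)) (b2 : 'cV[R]_m2).

Definition int_nonneg : set 'cV[R]_n :=
  [set x : 'cV[R]_n | (forall j, x j 0 \is a Num.int) /\ 0 <=v x].

Definition halfspaces : set 'cV[R]_n := [set x : 'cV[R]_n | A1 *m x <=v b1].

Definition Qset : set 'cV[R]_n :=
  [set x : 'cV[R]_n | int_nonneg x /\ A2 *m x <=v b2].

Definition feasible : set 'cV[R]_n := Qset `&` halfspaces.

Variable C : 'M[R]_(k, n).

Definition efficient (xs : 'cV[R]_n) : Prop :=
  feasible xs /\ ~ exists2 x, feasible x & C *m xs <v C *m x.

Definition supported_efficient (xs : 'cV[R]_n) : Prop :=
  efficient xs /\
  exists mu : 'cV[R]_k, (forall i, 0 < mu i 0) /\
    forall x, feasible x -> (mu^T *m C *m x) 0 0 <= (mu^T *m C *m xs) 0 0.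

Definition Y_LR (L : 'M[R]_(k, m1)) : set 'cV[R]_k :=
  [set C *m x + L *m (b1 - A1 *m x) | x in Qset].

(* [points_of] discards the formal symbols from the union. *)
Definition Y_LD : set 'cV[R]_k :=
  \bigcup_(L in [set L : 'M[R]_(k, m1) | 0 <=v L]) points_of (Max (Y_LR L)).

Definition strong_at (x : 'cV[R]_n) : Prop :=
  exists2 y, points_of (Min Y_LD) y & y = C *m x.

End MOIP.

(* Main.v *)
Require Import Defs.
From mathcomp Require Import all_boot all_order all_algebra.
From mathcomp Require Import all_classical all_reals.
From mathcomp Require Import ring lra.
Import Order.TTheory GRing.Theory Num.Theory.
Local Open Scope classical_set_scope.
Local Open Scope ring_scope.

(** Write Q for the lattice points, H for the relaxed halfspaces,
    F = Q `&` H, and s(x) = b1 - A1 x for the slack.  Only the inclusion of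
    conv Q `&` H in conv F needs an argument.  It rests on two applications of
    strong duality, both with cost matrices whose supported efficient solutions
    are obvious.

    First take C with rows 1, -1, 0, ..., 0, where 1 is the all-ones row.  The
    rows add up to zero, so every feasible point is supported efficient.  The
    first row of the multiplier given by strong duality is a vector ut >= 0
    such that (sum of the x_j) + ut s(x) is bounded above on Q
    ([coercive_multiplier]).  Since ut s(x) >= 0 on F, the coordinate sums are
    bounded on F, so F is finite.  In particular conv F is closed although the
    data may be irrational, and a point z of H `&` conv Q outside conv F is
    strictly separated from F: c x < c z for all x in F, by Gordan's
    alternative ([gordan], [separation]).

    Then take C with rows c, 0, ..., 0, and let xs maximise c over F; it is
    supported efficient.  Strong duality gives a multiplier with rows u and
    w_i such that C xs is not dominated by any (c x + u s(x), w_i s(x)) with x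
    in Q, and the set Y_LD is bounded below.  Maximise
    g(x) = c x + (u + e ut) s(x) over Q, for a small e > 0: the term in ut
    makes the superlevel sets of g finite, so the maximum is attained; as g is
    affine and z is in conv Q `&` H, it is at least c z.  For e small a
    maximiser x therefore satisfies c x + u s(x) > c xs.  Among the maximisers
    choose one that maximises the sum of the w_i s(x).  The point it defines
    stays nondominated when all the w_i are multiplied by the same r > 0, so
    every r w_i s(x) is a coordinate of a point of Y_LD; boundedness below
    forces w_i s(x) >= 0 ([multipliers_ge0_at_lex_argmax]).  Hence x dominates
    C xs, a contradiction ([no_separation]). *)

(** * Gordan's alternative and separation from a finite set *)

Section Gordan.
Context {R : realType} {n : nat}.
Implicit Types (c : 'rV[R]_n) (d x : 'cV[R]_n) (s : seq 'cV[R]_n).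

Definition dot c d : R := (c *m d) 0 0.

Lemma dotDl c c' d : dot (c + c') d = dot c d + dot c' d.
Proof. by rewrite /dot mulmxDl mxE. Qed.

Lemma dot0l d : dot 0 d = 0.
Proof. by rewrite /dot mul0mx mxE. Qed.

Lemma dotZl t c d : dot (t *: c) d = t * dot c d.
Proof. by rewrite /dot -scalemxAl mxE. Qed.

Lemma dotBr c d d' : dot c (d - d') = dot c d - dot c d'.
Proof. by rewrite /dot mulmxBr mxE [X in _ + X]mxE. Qed.

Lemma dotZr t c d : dot c (t *: d) = t * dot c d.
Proof. by rewrite /dot -scalemxAr mxE. Qed.

Lemma dot_sumr c N (z : 'I_N -> 'cV[R]_n) :
  dot c (\sum_(i < N) z i) = \sum_(i < N) dot c (z i).
Proof. by rewrite /dot mulmx_sumr summxE. Qed.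

Lemma dot_ge0 c d : 0 <=v c -> 0 <=v d -> 0 <= dot c d.
Proof.
move=> c0 d0; rewrite /dot mxE sumr_ge0// => j _; apply: mulr_ge0.
  by have := c0 0 j; rewrite mxE.
by have := d0 j 0; rewrite mxE.
Qed.

Lemma dot_trmx_gt0 d : d != 0 -> 0 < dot d^T d.
Proof.
move=> d0; have sq_ge0 j : 0 <= d j 0 * d j 0 by rewrite -expr2 sqr_ge0.
have dotE : dot d^T d = \sum_j d j 0 * d j 0.
  by rewrite /dot mxE; apply: eq_bigr => j _; rewrite mxE.
rewrite lt_neqAle dotE sumr_ge0 ?andbT //; apply: contra d0.
rewrite eq_sym psumr_eq0 // => /allP dj0; apply/eqP/matrixP => j i.
have := dj0 j (mem_index_enum j).
by rewrite mulf_eq0 orbb ord1 mxE => /eqP.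
Qed.

Lemma perturb_neg s (p q : 'cV[R]_n -> R) :
  (forall d, d \in s -> p d < 0) ->
  exists2 e : R, 0 < e & forall d, d \in s -> p d + e * q d < 0.
Proof.
elim: s => [|d0 s IHs] ps; first by exists 1.
have [|e e_gt0 He] := IHs; first by move=> d ds; apply: ps; rewrite inE ds orbT.
have p0 : p d0 < 0 by apply: ps; rewrite mem_head.
pose e0 := - p d0 / (1 + `|q d0|).
have e0_gt0 : 0 < e0 by rewrite divr_gt0 ?oppr_gt0 // ltr_wpDr.
have small t : 0 < t -> t <= e0 -> p d0 + t * q d0 < 0.
  move=> t0; rewrite ler_pdivlMr ?ltr_wpDr // => te.
  by have := ler_wpM2l (ltW t0) (ler_norm (q d0)); nra.
exists (Num.min e e0); first by rewrite lt_min e_gt0.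
move=> d; rewrite inE => /predU1P[->|ds].
  by apply: small; rewrite ?lt_min ?e_gt0 // ge_min lexx orbT.
have pd : p d < 0 by apply: ps; rewrite inE ds orbT.
have He' := He _ ds; set t := Num.min _ _.
have t0 : 0 < t by rewrite lt_min e_gt0.
have te : t <= e by rewrite ge_min lexx.
by have [q0|q0] := lerP 0 (q d); nra.
Qed.

(** Induction on the number of vectors.  Let d0 be the head and let c be
    negative on the tail; only the case c d0 >= 0 is not immediate.  If
    c d0 = 0, tilt c slightly against d0.  If c d0 > 0, project along d0 onto
    the hyperplane orthogonal to c: the projections of the tail, scaled by
    c d0, are nonnegative combinations of the tail vectors and d0, so that a
    vanishing combination of them unfolds into one of the original vectors;
    otherwise some c' is negative on the projections, and subtracting from c'
    slightly more than the multiple of c that kills d0 gives the witness. *)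
Lemma gordan s :
  (exists a : nat -> R, [/\ forall i, 0 <= a i,
      \sum_(i < size s) a i = 1 & \sum_(i < size s) a i *: s`_i = 0]) \/
  exists c, forall d, d \in s -> dot c d < 0.
Proof.
have [N sizeN] : exists N, size s = N by exists (size s).
elim: N s sizeN => [|N IHN] [|d0 s] //= => [_|[sizeN]].
  by right; exists 0.
have [-> | d0_neq0] := eqVneq d0 0.
  left; exists (fun i => (i == 0)%:R); split=> [i||]; first exact: ler0n.
    by rewrite big_ord_recl big1 ?addr0.
  by rewrite big_ord_recl big1 ?addr0 ?scaler0 // => i _; rewrite scale0r.
have [[a [a_ge0 a1 a0]]|[c cs]] := IHN s sizeN.
  left; exists (fun i => if i is j.+1 then a j else 0); split.
  - by case.
  - by rewrite big_ord_recl add0r.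
  - by rewrite big_ord_recl scale0r add0r.
have [c_neg|c_pos|c_zero] := ltgtP (dot c d0) 0.
- by right; exists c => d; rewrite inE => /predU1P[->|/cs].
- pose f d := dot c d0 *: d - dot c d *: d0.
  have [|[a [a_ge0 a1 a0]]|[c' c's]] := IHN [seq f d | d <- s].
  + by rewrite size_map.
  + rewrite size_map in a1 a0.
    (* weights of d0 and of the tail in the unfolded combination, which still
       has to be normalised *)
    pose b i := if i is j.+1 then a j * dot c d0
                else - \sum_(j < size s) a j * dot c s`_j.
    have b_ge0 i : 0 <= b i.
      case: i => [|i] /=; last by rewrite mulr_ge0 // ltW.
      rewrite oppr_ge0 sumr_le0 // => j _; rewrite mulr_ge0_le0 // ltW //.
      by rewrite cs // mem_nth.
    pose B := \sum_(i < (size s).+1) b i.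
    have B_gt0 : 0 < B.
      rewrite /B big_ord_recl /=; apply: ltr_wpDl; first exact: (b_ge0 0).
      by rewrite -mulr_suml a1 mul1r.
    have b0 : \sum_(i < (size s).+1) b i *: (d0 :: s)`_i = 0.
      rewrite big_ord_recl /= -[RHS]a0 scaleNr scaler_suml addrC -sumrB.
      apply: eq_bigr => j _; rewrite (nth_map 0) // /f scalerBr !scalerA.
      by [].
    left; exists (fun i => B^-1 * b i); split.
    * by move=> i; rewrite mulr_ge0 // invr_ge0 ltW.
    * by rewrite -mulr_sumr mulVf // gt_eqF.
    * under eq_bigr do rewrite -scalerA.
      by rewrite -scaler_sumr b0 scaler0.
  + pose r := dot c' d0 / dot c d0.
    pose c1 := c' - r *: c.
    have dot_c1 d : dot c1 d = dot c' d - r * dot c d.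
      by rewrite /c1 -scaleNr dotDl dotZl mulNr.
    have c1s d : d \in s -> dot c1 d < 0.
      move=> ds; have := c's _ (map_f f ds).
      rewrite dotBr !dotZr => neg; rewrite dot_c1 -(pmulr_llt0 _ c_pos).
      suff -> : (dot c' d - r * dot c d) * dot c d0 =
          dot c d0 * dot c' d - dot c d * dot c' d0 by [].
      by rewrite /r; field; rewrite gt_eqF.
    have [e e_gt0 He] := perturb_neg s (dot c1) (fun d => - dot c d) c1s.
    right; exists (c1 + - e *: c) => d; rewrite inE dotDl dotZl mulNr.
    case/predU1P => [->|/He]; last by rewrite mulrN.
    rewrite dot_c1 /r divfK ?gt_eqF // subrr add0r oppr_lt0.
    exact: mulr_gt0.
- have [e e_gt0 He] := perturb_neg s (dot c) (fun d => - dot d0^T d) cs.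
  right; exists (c + - e *: d0^T) => d; rewrite inE dotDl dotZl mulNr.
  case/predU1P => [->|/He]; last by rewrite mulrN.
  by rewrite c_zero add0r oppr_lt0 mulr_gt0 // dot_trmx_gt0.
Qed.

Lemma separation s (S : set 'cV[R]_n) z :
  (forall x, x \in s -> S x) -> ~ conv_hull S z ->
  exists c, forall x, x \in s -> dot c x < dot c z.
Proof.
move=> sS zS; have [[a [a_ge0 a1 a0]]|[c cs]] := gordan [seq x - z | x <- s].
  rewrite size_map in a1 a0; case: zS.
  exists (size s), (fun i => a i), (fun i => s`_i); split => //.
    by move=> i; apply/sS/mem_nth.
  apply/esym/subr0_eq; rewrite -[in LHS](scale1r z) -[in LHS]a1 scaler_suml.
  rewrite -sumrB -[RHS]a0; apply: eq_bigr => i _.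
  by rewrite (nth_map 0) // scalerBr.
exists c => x xs; have := cs _ (map_f (fun x => x - z) xs).
by rewrite dotBr subr_lt0.
Qed.

End Gordan.

(** * Maxima over lattice points *)

Section LatticePoints.
Context {R : realType} {n : nat}.
Implicit Types (S : set 'cV[R]_n) (g h : 'cV[R]_n -> R).

Definition coord_sum (x : 'cV[R]_n) : R := \sum_j x j 0.

Lemma finite_bounded_coord_sum S (M : R) : S `<=` @int_nonneg R n ->
  (forall x, S x -> coord_sum x <= M) ->
  exists s : seq 'cV[R]_n, forall x, (x \in s) = `[< S x >].
Proof.
move=> SN SM; pose K := Num.truncn M.
pose pt (f : {ffun 'I_n -> 'I_K.+1}) : 'cV[R]_n := \col_j (f j)%:R.
exists [seq x <- [seq pt f | f : {ffun 'I_n -> 'I_K.+1}] | `[< S x >]] => x.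
rewrite mem_filter; case: asboolP => //= Sx.
have [xint x_ge0] := SN _ Sx.
have xj_ge0 j : 0 <= x j 0 by have := x_ge0 j 0; rewrite mxE.
have x_nat j : x j 0 = (Num.truncn (x j 0))%:R.
  by apply/esym/eqP; rewrite -natrE natrEint xint xj_ge0.
have xjM j : x j 0 <= M.
  apply: le_trans (SM x Sx); rewrite /coord_sum (bigD1 j) //= lerDl.
  exact: sumr_ge0.
apply/mapP; exists [ffun j => inord (Num.truncn (x j 0))].
  by rewrite mem_enum.
apply/colP => j; rewrite !mxE ffunE inordK -?x_nat // ltnS.
by apply: le_truncn.
Qed.

Lemma argmax_seq S g (s : seq 'cV[R]_n) :
  (exists x, S x) -> (forall x, S x -> x \in s) ->
  exists2 x, S x & forall y, S y -> g y <= g x.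
Proof.
elim: s S => [|a s IHs] S [x0 Sx0] Ss; first by have := Ss _ Sx0.
have [[x1 [Sx1 x1a]]|none] := pselect (exists x, S x /\ x <> a).
  have [||x [Sx xa] xmax] := IHs [set x | S x /\ x <> a]; first by exists x1.
    by move=> x [/Ss]; rewrite inE => /predU1P[].
  have [Sa|nSa] := pselect (S a); last first.
    by exists x => // y Sy; apply: xmax; split=> // ya; rewrite ya in Sy.
  have [ga|ga] := lerP (g a) (g x).
    exists x => // y Sy; have [->//|ya] := eqVneq y a.
    by apply: xmax; split=> //; apply/eqP.
  exists a => // y Sy; have [->//|ya] := eqVneq y a.
  by apply: le_trans (ltW ga); apply: xmax; split=> //; apply/eqP.
exists x0 => // y Sy.
have eqa x : S x -> x = a by move=> Sx; apply: contra_notP none; exists x.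
by rewrite (eqa _ Sx0) (eqa _ Sy).
Qed.

(** The bound on [g] makes its superlevel sets in [S] finite, as they have
    bounded coordinate sums. *)
Lemma lex_argmax S g h (B e : R) : S `<=` @int_nonneg R n -> (exists x, S x) ->
  0 < e -> (forall x, S x -> g x <= B - e * coord_sum x) ->
  exists x, [/\ S x, forall y, S y -> g y <= g x &
                     forall y, S y -> g y = g x -> h y <= h x].
Proof.
move=> SN [x0 Sx0] e0 gB; pose S1 := [set x | S x /\ g x0 <= g x].
have [|x [Sx /= g0x]|s sP] := @finite_bounded_coord_sum S1 ((B - g x0) / e).
- by move=> x [/SN].
- by rewrite ler_pdivlMr // mulrC; have := gB _ Sx; lra.
have S1s x : S1 x -> x \in s by rewrite sP => S1x; apply/asboolP.
have [|x1 [Sx1 g01] x1max] := @argmax_seq S1 g s _ S1s; first by exists x0.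
have gmax y : S y -> g y <= g x1.
  move=> Sy; have [g0y|/ltW gy0] := lerP (g x0) (g y); first exact: x1max.
  exact: le_trans g01.
pose S2 := [set x | S x /\ g x = g x1].
have [||x2 [Sx2 g2] x2max] := @argmax_seq S2 h s; first by exists x1.
  by move=> x [Sx gx]; apply: S1s; split=> //; rewrite gx.
by exists x2; rewrite g2; split=> // y Sy gy; apply: x2max.
Qed.

End LatticePoints.

(** * Affine inequalities on convex hulls *)

Section Convex.
Context {R : realType} {n : nat}.

Lemma conv_hull_le (S : set 'cV[R]_n) (c : 'rV[R]_n) (B : R) z :
  (forall x, S x -> dot c x <= B) -> conv_hull S z -> dot c z <= B.
Proof.
move=> cB [N [a [y [a_ge0 a1 Sy ->]]]]; rewrite dot_sumr -[B]mul1r -a1 mulr_suml.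
by apply: ler_sum => i _; rewrite dotZr ler_wpM2l // cB.
Qed.

Lemma conv_hullS (S T : set 'cV[R]_n) :
  S `<=` T -> conv_hull S `<=` conv_hull T.
Proof.
by move=> ST x [N [a [y [? ? Sy ?]]]]; exists N, a, y; split=> // i; apply: ST.
Qed.

Lemma conv_hull_halfspaces m1 (A1 : 'M[R]_(m1, n)) (b1 : 'cV[R]_m1) :
  conv_hull (halfspaces A1 b1) `<=` halfspaces A1 b1.
Proof.
move=> z zH i j; rewrite ord1.
have mulE x : (A1 *m x) i 0 = dot (row i A1) x by rewrite /dot -row_mul [RHS]mxE.
rewrite mulE; apply: conv_hull_le zH => x xH.
by rewrite -mulE; apply: xH.
Qed.

End Convex.

(** * Lagrangian functions and the dual *)

Section Lagrangian.
Context {R : realType} {k n m1 m2 : nat}.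
Context {A1 : 'M[R]_(m1, n)} {b1 : 'cV[R]_m1}.
Context {A2 : 'M[R]_(m2, n)} {b2 : 'cV[R]_m2}.
Implicit Types (C : 'M[R]_(k, n)) (L : 'M[R]_(k, m1)) (x z : 'cV[R]_n).

Local Notation Q := (Qset A2 b2).
Local Notation F := (feasible A1 b1 A2 b2).

Definition slack x : 'cV[R]_m1 := b1 - A1 *m x.

Definition lagr (c : 'rV[R]_n) (u : 'rV[R]_m1) x : R := dot c x + dot u (slack x).

Lemma slack_ge0 x : halfspaces A1 b1 x -> 0 <=v slack x.
Proof. by move=> xH i j; rewrite mxE /slack !mxE subr_ge0 //; have := xH i j; rewrite mxE. Qed.

Lemma lagrE C L x i :
  (C *m x + L *m (b1 - A1 *m x)) i 0 = lagr (row i C) (row i L) x.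
Proof. by rewrite mxE /lagr /dot -!row_mul [in RHS]mxE [X in _ = _ + X]mxE. Qed.

Lemma costE C x i : (C *m x) i 0 = dot (row i C) x.
Proof. by rewrite /dot -row_mul [RHS]mxE. Qed.

Lemma conv_hull_lagr_le c u (B : R) z :
  (forall x, Q x -> lagr c u x <= B) -> conv_hull Q z -> lagr c u z <= B.
Proof.
have lagr_affine x : lagr c u x = dot (c - u *m A1) x + dot u b1.
  by rewrite /lagr /dot /slack mulmxBr mulmxBl mulmxA !mxE; ring.
move=> uB zQ; rewrite lagr_affine -lerBrDr.
by apply: conv_hull_le zQ => x xQ; rewrite lerBrDr -lagr_affine uB.
Qed.

Lemma lagr_ge c u x : 0 <=v u -> halfspaces A1 b1 x -> dot c x <= lagr c u x.
Proof. by move=> u0 xH; rewrite lerDl dot_ge0 //; apply: slack_ge0. Qed.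

(** Strong duality carries two separate pieces of information: a Lagrangian
    relaxation in which [C *m x] is nondominated, and the boundedness below of
    [Y_LD], without which [Min] is a formal symbol and has no points. *)
Lemma strong_atP C x : strong_at A1 b1 A2 b2 C x ->
  bounded_below (Y_LD A1 b1 A2 b2 C) /\
  exists L, [/\ 0 <=v L, bounded_above (Y_LR A1 b1 A2 b2 C L) &
    ~ exists2 t, Y_LR A1 b1 A2 b2 C L t & C *m x <v t].
Proof.
move=> [y yMin yE]; move: yMin; rewrite {}yE /Min.
case: asboolP => // _; case: asboolP => //= YLDb [[L L0 yMax] _].
split=> //; exists L; move: yMax; rewrite /Max.
by case: asboolP => // _; case: asboolP => //= YLRb [_ ndom].
Qed.

Lemma Y_LD_intro C L x : 0 <=v L -> bounded_above (Y_LR A1 b1 A2 b2 C L) ->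
  Q x -> (forall y, Q y ->
    ~ C *m x + L *m (b1 - A1 *m x) <v C *m y + L *m (b1 - A1 *m y)) ->
  Y_LD A1 b1 A2 b2 C (C *m x + L *m (b1 - A1 *m x)).
Proof.
move=> L0 Lb xQ ndom; exists L => //; rewrite /Max.
have Yx : Y_LR A1 b1 A2 b2 C L (C *m x + L *m (b1 - A1 *m x)) by exists x.
case: asboolP => [Y0|_]; first by rewrite Y0 in Yx.
case: asboolP => // _; split=> // -[_ [y yQ <-]]; exact: ndom.
Qed.

(** The weight vector is the all-ones vector; being positive, it makes a
    maximiser of the weighted objective efficient. *)
Lemma supported_efficient1 C x : F x ->
  (forall y, F y -> dot (\sum_i row i C) y <= dot (\sum_i row i C) x) ->
  supported_efficient A1 b1 A2 b2 C x.
Proof.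
have sumE y : dot (\sum_i row i C) y = \sum_i (C *m y) i 0.
  rewrite /dot mulmx_suml summxE; apply: eq_bigr => i _.
  by rewrite -row_mul [LHS]mxE.
move=> xF xmax; split; last first.
  exists (const_mx 1); split=> [i|y yF]; first by rewrite mxE.
  suff -> : (const_mx 1 : 'cV[R]_k)^T *m C = \sum_i row i C by exact: xmax.
  apply/rowP => j; rewrite mxE summxE; apply: eq_bigr => i _.
  by rewrite !mxE mul1r.
split=> // -[y yF [le_xy neq_xy]]; apply: neq_xy; apply/colP => i.
have := xmax _ yF; rewrite !sumE => le_yx.
have sum0 : \sum_i ((C *m y) i 0 - (C *m x) i 0) == 0.
  rewrite eq_le sumrB subr_le0 le_yx subr_ge0; apply: ler_sum => j _.
  exact: le_xy.
move: sum0; rewrite psumr_eq0; last by move=> j _; rewrite subr_ge0 le_xy.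
by move/allP/(_ i (mem_index_enum i)); rewrite subr_eq0 => /eqP.
Qed.

End Lagrangian.

Lemma ge0_of_lbounded_multiples (R : realType) (l t : R) :
  (forall r, 0 < r -> l <= r * t) -> 0 <= t.
Proof.
move=> lb; rewrite leNgt; apply/negP => t0.
have r_gt0 : 0 < (`|l| + 1) / - t by rewrite divr_gt0 ?oppr_gt0 // ltr_wpDl.
have := lb _ r_gt0.
have -> : (`|l| + 1) / - t * t = - (`|l| + 1) by field; rewrite lt_eqF.
by have := ler_norm (- l); rewrite normrN; lra.
Qed.

(** * Consequences of strong duality *)

Section Duality.
Context {R : realType} {k n m1 m2 : nat}.
Context {A1 : 'M[R]_(m1, n)} {b1 : 'cV[R]_m1}.
Context {A2 : 'M[R]_(m2, n)} {b2 : 'cV[R]_m2}.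
Implicit Types (C : 'M[R]_(k, n)) (L : 'M[R]_(k, m1)) (x z : 'cV[R]_n).

Local Notation Q := (Qset A2 b2).
Local Notation F := (feasible A1 b1 A2 b2).
Local Notation slack := (@slack R n m1 A1 b1).
Local Notation lagr := (@lagr R n m1 A1 b1).

(** Multiplying the rows of [L] other than [i0] by r > 0 changes neither the
    first criterion of the lexicographic maximisation nor the ranking by the
    second one, so [x] defines a point of [Y_LD] for every r.  Its coordinate
    [i] is r times the quantity in the conclusion and would tend to minus
    infinity with r if that quantity were negative. *)
Lemma multipliers_ge0_at_lex_argmax C L (i0 : 'I_k) x :
  (forall i, i != i0 -> row i C = 0) -> 0 <=v L ->
  bounded_above (Y_LR A1 b1 A2 b2 C L) ->
  bounded_below (Y_LD A1 b1 A2 b2 C) -> Q x ->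
  (forall y, Q y -> lagr (row i0 C) (row i0 L) y <= lagr (row i0 C) (row i0 L) x) ->
  (forall y, Q y -> lagr (row i0 C) (row i0 L) y = lagr (row i0 C) (row i0 L) x ->
     \sum_(i | i != i0) dot (row i L) (slack y)
       <= \sum_(i | i != i0) dot (row i L) (slack x)) ->
  forall i, i != i0 -> 0 <= dot (row i L) (slack x).
Proof.
move=> C0 L0 [B LB] [l lLD] xQ gmax hmax i ii0.
apply: (@ge0_of_lbounded_multiples _ (l i 0)) => r r_gt0.
pose Lr : 'M[R]_(k, m1) := \matrix_j (if j == i0 then row i0 L else r *: row j L).
have rowLr0 : row i0 Lr = row i0 L by rewrite rowK eqxx.
have rowLr j : j != i0 -> row j Lr = r *: row j L.
  by move=> /negPf ji0; rewrite rowK ji0.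
have YLr j y : j != i0 ->
    (C *m y + Lr *m (b1 - A1 *m y)) j 0 = r * dot (row j L) (slack y).
  by move=> ji0; rewrite lagrE /lagr C0 // rowLr // dot0l add0r dotZl.
have YL j y : j != i0 ->
    (C *m y + L *m (b1 - A1 *m y)) j 0 = dot (row j L) (slack y).
  by move=> ji0; rewrite lagrE /lagr C0 // dot0l add0r.
have <- : (C *m x + Lr *m (b1 - A1 *m x)) i 0 = r * dot (row i L) (slack x).
  exact: YLr.
apply: lLD; apply: Y_LD_intro => //.
- move=> p q; rewrite !mxE; have := L0 p q; rewrite !mxE => Lpq.
  by case: eqP => [<-|_]; rewrite !mxE // mulr_ge0 // ltW.
- exists (\col_j (if j == i0 then B i0 0 else r * B j 0)) => _ [y yQ <-] j q.
  rewrite ord1 [leRHS]mxE; have Bj p := LB _ (imageP _ yQ) p 0.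
  case: eqVneq => [->|ji0].
    by rewrite lagrE rowLr0 -lagrE.
  by rewrite YLr // ler_pM2l // -YL.
- move=> y yQ [le_xy neq_xy]; apply: neq_xy.
  have geq : lagr (row i0 C) (row i0 L) y = lagr (row i0 C) (row i0 L) x.
    apply: le_anti; rewrite gmax //=.
    by have := le_xy i0 0; rewrite !lagrE rowLr0.
  have le_j j : j != i0 -> dot (row j L) (slack x) <= dot (row j L) (slack y).
    by move=> ji0; have := le_xy j 0; rewrite !YLr // ler_pM2l.
  have : \sum_(j | j != i0)
      (dot (row j L) (slack y) - dot (row j L) (slack x)) == 0.
    rewrite eq_le sumrB subr_le0 hmax //= subr_ge0.
    exact: ler_sum.
  rewrite psumr_eq0; last by move=> j ji0; rewrite subr_ge0 le_j.
  move=> /allP eq_j; apply/colP => j; have [->|ji0] := eqVneq j i0.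
    by rewrite !lagrE rowLr0 geq.
  have := eq_j j (mem_index_enum j); rewrite ji0 subr_eq0 => /eqP eq_yx.
  by rewrite !YLr // eq_yx.
Qed.

Hypothesis strong : forall C x,
  supported_efficient A1 b1 A2 b2 C x -> strong_at A1 b1 A2 b2 C x.

(** The cost rows 1, -1, 0, ..., 0 add up to zero, which makes any feasible
    point supported efficient.  The bound on [Y_LR] in the coordinate of the
    row 1 is the claim. *)
Lemma coercive_multiplier : (2 <= k)%N -> (exists x, F x) ->
  exists (u : 'rV[R]_m1) (M : R),
    0 <=v u /\ forall x, Q x -> coord_sum x + dot u (slack x) <= M.
Proof.
move=> k2 [x0 x0F].
pose i0 := Ordinal (ltnW k2); pose i1 := Ordinal k2.
have i01 : i1 != i0 by [].
pose C : 'M[R]_(k, n) :=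
  \matrix_i (if i == i0 then const_mx 1 else if i == i1 then - const_mx 1 else 0).
have sumC : \sum_i row i C = 0.
  rewrite (bigD1 i0) //= (bigD1 i1) //= !rowK eqxx (negPf i01) eqxx.
  rewrite big1 ?addr0 ?subrr // => i /andP[/negPf ii0 /negPf ii1].
  by rewrite rowK ii0 ii1.
have /strong_atP[_ [L [L0 [B LB] _]]] : strong_at A1 b1 A2 b2 C x0.
  by apply/strong/supported_efficient1 => // y _; rewrite sumC !dot0l.
exists (row i0 L), (B i0 0); split=> [p q|x xQ].
  by have := L0 i0 q; rewrite !mxE.
have := LB _ (imageP _ xQ) i0 0; rewrite lagrE rowK eqxx /lagr.
suff -> : dot (const_mx 1) x = coord_sum x by [].
by rewrite /dot mxE; apply: eq_bigr => j _; rewrite mxE mul1r.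
Qed.

Lemma finite_feasible : (2 <= k)%N -> (exists x, F x) ->
  exists s : seq 'cV[R]_n, forall x, (x \in s) = `[< F x >].
Proof.
move=> k2 Fne; have [u [M [u0 uM]]] := coercive_multiplier k2 Fne.
apply: (@finite_bounded_coord_sum _ _ _ M) => [x [[]] //|x [xQ xH]].
by apply: le_trans (uM _ xQ); rewrite lerDl; apply: dot_ge0 => //; apply: slack_ge0.
Qed.

(** With cost rows c, 0, ..., 0, the relaxed values in the zero rows are pure
    slack terms, which [multipliers_ge0_at_lex_argmax] shows to be nonnegative
    at a maximiser; a gap in the row c would then make the relaxation dominate
    the feasible maximum of c, against strong duality. *)
Lemma no_separation z : (2 <= k)%N -> (exists x, F x) ->
  conv_hull Q z -> halfspaces A1 b1 z ->
  forall c : 'rV[R]_n, exists2 x, F x & dot c z <= dot c x.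
Proof.
move=> k2 Fne zQ zH c; pose i0 := Ordinal (ltnW k2).
have [ut [M [ut0 utM]]] := coercive_multiplier k2 Fne.
have QN : Q `<=` @int_nonneg R n by move=> x [].
have [s sF] := finite_feasible k2 Fne.
have [|xs xsF xsmax] := argmax_seq F (dot c) s Fne.
  by move=> x xF; rewrite sF; apply/asboolP.
exists xs => //; rewrite leNgt; apply/negP => gap.
pose C : 'M[R]_(k, n) := \matrix_i (if i == i0 then c else 0).
have rowC0 : row i0 C = c by rewrite rowK eqxx.
have rowC i : i != i0 -> row i C = 0 by move=> /negPf ii0; rewrite rowK ii0.
have sumC : \sum_i row i C = c.
  by rewrite (bigD1 i0) //= rowC0 big1 ?addr0.
have /strong_atP[LDb [L [L0 [B LB] ndom]]] : strong_at A1 b1 A2 b2 C xs.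
  by apply/strong/supported_efficient1; rewrite ?sumC.
have coord_sumQ x : Q x -> 0 <= coord_sum x.
  move=> [[_ x0] _]; apply: sumr_ge0 => j _.
  by have := x0 j 0; rewrite mxE.
(* The coercive term e * ut s(x) is at most e * M on Q, so this e keeps it
   below the gap between c z and c xs. *)
pose e := (dot c z - dot c xs) / (`|M| + 1).
have e_gt0 : 0 < e by rewrite divr_gt0 ?subr_gt0 ?ltr_wpDl.
have eM : e * M < dot c z - dot c xs.
  have : e * (`|M| + 1) = dot c z - dot c xs.
    by rewrite /e divfK // gt_eqF // ltr_wpDl.
  by have := ler_wpM2l (ltW e_gt0) (ler_norm M); lra.
pose L' : 'M[R]_(k, m1) :=
  \matrix_i (if i == i0 then row i0 L + e *: ut else row i L).
have rowL'0 : row i0 L' = row i0 L + e *: ut by rewrite rowK eqxx.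
have rowL' i : i != i0 -> row i L' = row i L.
  by move=> /negPf ii0; rewrite rowK ii0.
have L'0 : 0 <=v L'.
  move=> p q; rewrite !mxE; have := L0 p q; rewrite mxE => Lpq.
  case: eqP => [<-|_]; rewrite !mxE // addr_ge0 // mulr_ge0 ?(ltW e_gt0) //.
  by have := ut0 0 q; rewrite mxE.
have lagrL' y : lagr c (row i0 L') y =
    lagr c (row i0 L) y + e * dot ut (slack y).
  by rewrite rowL'0 /lagr dotDl dotZl addrA.
have lagrLB y : Q y -> lagr c (row i0 L) y <= B i0 0.
  by move=> yQ; have := LB _ (imageP _ yQ) i0 0; rewrite lagrE rowC0.
have coercive y : Q y -> lagr c (row i0 L') y <= (B i0 0 + e * M) - e * coord_sum y.
  move=> yQ; rewrite lagrL'; have := lagrLB _ yQ.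
  by have := ler_wpM2l (ltW e_gt0) (utM _ yQ); lra.
have Qne : exists x, Q x by case: Fne => x [xQ _]; exists x.
have [x [xQ xmax xlex]] := lex_argmax Q (lagr c (row i0 L'))
  (fun y => \sum_(i | i != i0) dot (row i L') (slack y)) _ e QN Qne e_gt0 coercive.
have xz : dot c xs < lagr c (row i0 L) x.
  have row0 : 0 <=v row i0 L' by move=> p q; have := L'0 i0 q; rewrite !mxE.
  have := le_trans (lagr_ge c _ _ row0 zH) (conv_hull_lagr_le _ _ _ _ xmax zQ).
  rewrite lagrL'; have := ler_wpM2l (ltW e_gt0) (utM _ xQ).
  have := mulr_ge0 (ltW e_gt0) (coord_sumQ _ xQ); lra.
have L'b : bounded_above (Y_LR A1 b1 A2 b2 C L').
  exists (\col_i (if i == i0 then B i0 0 + e * M else B i 0)) => _ [y yQ <-] i q.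
  rewrite ord1 lagrE [leRHS]mxE; case: eqVneq => [->|ii0].
    rewrite rowC0; apply: le_trans (coercive _ yQ) _.
    by rewrite lerBlDr lerDl mulr_ge0 ?(ltW e_gt0) ?coord_sumQ.
  by rewrite rowL' // -lagrE; apply: LB; exists y.
have Lx0 i : i != i0 -> 0 <= dot (row i L) (slack x).
  move=> ii0; rewrite -rowL' //.
  by apply: (multipliers_ge0_at_lex_argmax C L' i0); rewrite ?rowC0.
apply: ndom; exists (C *m x + L *m (b1 - A1 *m x)); first by exists x.
split=> [i q|/colP/(_ i0)].
  rewrite ord1 costE lagrE; have [->|ii0] := eqVneq i i0.
    by rewrite rowC0 ltW.
  by rewrite rowC // /lagr !dot0l add0r; apply: Lx0.
by rewrite costE lagrE rowC0 => eq_xs; rewrite eq_xs ltxx in xz.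
Qed.

End Duality.

Theorem theorem7 (R : realType) (k n m1 m2 : nat)
    (A1 : 'M[R]_(m1, n)) (b1 : 'cV[R]_m1)
    (A2 : 'M[R]_(m2, n)) (b2 : 'cV[R]_m2)
    (k_ge2 : (2 <= k)%N)
    (feasibleP : exists x : 'cV[R]_n, feasible A1 b1 A2 b2 x) :
  (forall (C : 'M[R]_(k, n)) (x : 'cV[R]_n),
     supported_efficient A1 b1 A2 b2 C x -> strong_at A1 b1 A2 b2 C x) ->
  conv_hull (Qset A2 b2 `&` halfspaces A1 b1) =
  conv_hull (Qset A2 b2) `&` halfspaces A1 b1.
Proof.
move=> strong; apply/seteqP; split=> [z zF|z [zQ zH]].
  split; first by apply: conv_hullS zF => x [].
  by apply: conv_hull_halfspaces; apply: conv_hullS zF => x [].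
have [s sF] := finite_feasible strong k_ge2 feasibleP.
apply: contrapT => zF; have [|c cz] := separation s _ z _ zF.
  by move=> x; rewrite sF => /asboolP.
have [x xF] := no_separation strong z k_ge2 feasibleP zQ zH c.
by rewrite leNgt cz // sF; apply/asboolP.
Qed.
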